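(* Let $k$ be a field and let $G$ be an almost Cohen-Macaulay bipartite graph (over $k$) with bipartition $V_1=\{x_1,\ldots,x_n\}$ and $V_2=\{y_1,\ldots,y_m\}$. If $G$ has at least one vertex of positive degree, then there is a vertex $v\in V_1\cup V_2$ such that $\deg(v)\leq 2$.
   Context: The graph $G$ is finite and simple (no loops, no multiple edges) and has no isolated vertices. It is bipartite with bipartition $V_1,V_2$: $V(G)=V_1\cup V_2$, $V_1\cap V_2=\emptyset$, and every edge joins a vertex of $V_1$ to a vertex of $V_2$. For a graph $G$, let $R$ be the polynomial ring over the field $k$ whose variables are the vertices of $G$. The edge ideal $I(G)\subseteq R$ is generated by all monomials $uv$ with $\{u,v\}\in E(G)$. The graph $G$ is called almost Cohen-Macaulay (aCM) if $\operatorname{depth} R/I(G)\geq \dim R/I(G)-1$. *)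

(* Defs.v *)
From HB Require Import structures.
From mathcomp Require Import all_boot all_order all_algebra.
From mathcomp Require Import mpoly.

Set Implicit Arguments.
Unset Strict Implicit.
Unset Printing Implicit Defensive.

Import GRing.Theory.
Local Open Scope ring_scope.

Definition is_max_nat (P : nat -> Prop) (d : nat) : Prop :=
  P d /\ forall d' : nat, P d' -> (d' <= d)%N.

(* Ideals are Prop-valued predicates, since membership in an arbitrary ideal
   (in particular in the primes of a chain) is not assumed decidable. *)
Section CommutativeAlgebra.
Variable R : comNzRingType.

Definition is_ideal (I : R -> Prop) : Prop :=
  [/\ I 0,
      forall a b : R, I a -> I b -> I (a + b)
    & forall r a : R, I a -> I (r * a)].

Definition is_prime_ideal (P : R -> Prop) : Prop :=
  [/\ is_ideal P, ~ P 1 & forall a b : R, P (a * b) -> P a \/ P b].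

Definition ideal_gen (S : R -> Prop) (f : R) : Prop :=
  forall J : R -> Prop, is_ideal J -> (forall s : R, S s -> J s) -> J f.

Definition subideal (I J : R -> Prop) : Prop := forall f : R, I f -> J f.

(* A chain P_0 < P_1 < ... < P_d of primes of R / I, given by the
   corresponding primes of R containing I; its length d is the number of
   strict inclusions. *)
Definition prime_chain_quot (I : R -> Prop) (d : nat) : Prop :=
  exists P : nat -> R -> Prop,
    (forall i : nat, (i <= d)%N -> is_prime_ideal (P i) /\ subideal I (P i)) /\
    (forall i : nat, (i < d)%N ->
       subideal (P i) (P i.+1) /\ ~ subideal (P i.+1) (P i)).

Definition krull_dim_quot (I : R -> Prop) (d : nat) : Prop :=
  is_max_nat (prime_chain_quot I) d.

Definition ideal_add_seq (I : R -> Prop) (s : seq R) : R -> Prop :=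
  ideal_gen (fun f : R => I f \/ f \in s).

(* With s = f_1, ..., f_r: each f_i is a nonzerodivisor on
   R / (I + (f_1, ..., f_{i-1})), and R / (I + (f_1, ..., f_r)) is nonzero. *)
Definition regular_seq_quot (I : R -> Prop) (s : seq R) : Prop :=
  (forall i : nat, (i < size s)%N -> forall g : R,
     ideal_add_seq I (take i s) (s`_i * g) -> ideal_add_seq I (take i s) g) /\
  ~ ideal_add_seq I s 1.

(* The depth of R / I with respect to the ideal m. *)
Definition depth_quot (m I : R -> Prop) (d : nat) : Prop :=
  is_max_nat
    (fun r : nat => exists s : seq R,
       [/\ size s = r, forall f : R, f \in s -> m f & regular_seq_quot I s]) d.

End CommutativeAlgebra.

Section Graphs.
Variable T : finType.

Definition simple_graph (e : rel T) : Prop := ssrbool.symmetric e /\ irreflexive e.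

Definition degree (e : rel T) (v : T) : nat := #|[set w | e v w]|.

Definition bipartition (e : rel T) (V1 V2 : {set T}) : Prop :=
  [/\ V1 :|: V2 = [set: T], V1 :&: V2 = set0
    & forall u v : T, e u v ->
        (u \in V1 /\ v \in V2) \/ (u \in V2 /\ v \in V1)].

Variable k : fieldType.

(* Variables of {mpoly k[N]} are indexed by 'I_N, whence the enumeration. *)
Definition vertex_var (v : T) : {mpoly k[#|T|]} := 'X_(enum_rank v).

Definition edge_ideal (e : rel T) : {mpoly k[#|T|]} -> Prop :=
  ideal_gen (fun f : {mpoly k[#|T|]} =>
    exists u v : T, e u v /\ f = vertex_var u * vertex_var v).

Definition irrelevant_ideal : {mpoly k[#|T|]} -> Prop :=
  ideal_gen (fun f : {mpoly k[#|T|]} => exists v : T, f = vertex_var v).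

(* The depth of the graded ring R / I(G) is taken at the irrelevant maximal
   ideal; depth and dimension are always finite here. *)
Definition almost_cohen_macaulay (e : rel T) : Prop :=
  exists dep dim : nat,
    [/\ depth_quot irrelevant_ideal (edge_ideal e) dep,
        krull_dim_quot (edge_ideal e) dim
      & (dim <= dep + 1)%N].

End Graphs.

(* Main.v *)
Require Import Defs.
From HB Require Import structures.
From mathcomp Require Import all_boot all_order all_algebra.
From mathcomp Require Import ring zify.
From mathcomp Require Import mpoly.
From Stdlib Require Import Classical ClassicalEpsilon.

Set Implicit Arguments.
Unset Strict Implicit.
Unset Printing Implicit Defensive.

Import Order.TTheory GRing.Theory.

(** Let y have the smallest degree among the vertices of V2, put A = N(y) and
    F = V1 \ A, and let B consist of the vertices of V2 without neighbour in F.
    A vertex of B has all its neighbours in A, hence by minimality is joined to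
    all of A: removing F and its neighbours leaves the complete bipartite graph
    on A and B. The link of F in the independence complex is thus disconnected,
    which bounds the depth of R/I(G) by #|F| + 1 = #|V1| - deg y + 1. Since the
    dimension is at least #|V1|, an almost Cohen-Macaulay graph has
    deg y <= 2.

    The depth bound is proved without homological algebra. Let S be the prime
    generated by the variables outside F, and let e be the product of the
    variables in F. Then S = P + Q for two primes P and Q generated by
    variables and containing I(G), and e P Q is contained in I(G). Two facts
    contradict each other when some regular sequence s in the irrelevant ideal
    m has #|F| + 2 terms.

    On the one hand ([no_regular_pair]) S contains no pair g1, g2 that is
    regular on the localization of R/I(G) at m: writing g_i = p_i + q_i along
    S = P + Q, the element g2 e p1 lies in I(G) + (g1), so u e p1 = g1 z modulo
    I(G) with u outside m, whence z lies in P and u e - z in Q, so that u e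
    would lie in S.

    On the other hand ([regular_pair]) s can be traded for such a pair. Modulo
    S there are only #|F| variables, so the terms f_1, ..., f_r of s satisfy an
    algebraic relation modulo S ([digit_monomial_dependence]): some nonzero
    polynomial g in the f_i lies in S. As in Noether normalization, replacing
    f_i by f_i' = f_i - f_1 ^ (D ^ (i - 1)) makes g congruent to a unit times a
    power of f_1 modulo the f_i', so g may replace f_1 ([exchange]). What is left
    has r - 1 > #|F| terms on the quotient by g, which allows a second exchange.
    Permuting regular sequences requires localization at m and the ascending
    chain condition ([regular_swapl]); the latter comes from Dickson's lemma
    ([mpoly_noetherian]). *)

(** * Ideals and localization at a prime *)

Section Ideals.
Local Open Scope ring_scope.
Variable R : comNzRingType.
Implicit Types (I J K P : R -> Prop) (a b f g x : R) (s : seq R).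

Lemma ideal0 K : is_ideal K -> K 0. Proof. by case. Qed.

Lemma idealD K a b : is_ideal K -> K a -> K b -> K (a + b).
Proof. by case=> _ h _; apply: h. Qed.

Lemma ideal_mulr K a b : is_ideal K -> K b -> K (a * b).
Proof. by case=> _ _ h; apply: h. Qed.

Lemma ideal_mull K a b : is_ideal K -> K a -> K (a * b).
Proof. by move=> hK ha; rewrite mulrC; apply: ideal_mulr. Qed.

Lemma idealN K a : is_ideal K -> K a -> K (- a).
Proof. by move=> hK ha; rewrite -mulN1r; apply: ideal_mulr. Qed.

Lemma idealB K a b : is_ideal K -> K a -> K b -> K (a - b).
Proof. by move=> hK ha hb; apply: idealD => //; apply: idealN. Qed.

Lemma ideal_subC K a b : is_ideal K -> K (a - b) -> K (b - a).
Proof. by move=> hK hab; rewrite -opprB; apply: idealN. Qed.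

Lemma ideal_sum K (A : Type) (r : seq A) (P : pred A) (F : A -> R) :
  is_ideal K -> (forall i, P i -> K (F i)) -> K (\sum_(i <- r | P i) F i).
Proof.
move=> hK h; apply: big_ind => //; first exact: ideal0.
by move=> a b; apply: idealD.
Qed.

Lemma ideal_congM K a b c d :
  is_ideal K -> K (a - b) -> K (c - d) -> K (a * c - b * d).
Proof.
move=> hK hab hcd; rewrite (_ : _ - _ = c * (a - b) + b * (c - d)); last by ring.
by apply: idealD => //; apply: ideal_mulr.
Qed.

Lemma ideal_congX K a b n : is_ideal K -> K (a - b) -> K (a ^+ n - b ^+ n).
Proof.
move=> hK hab; elim: n => [|n IH]; first by rewrite subrr; apply: ideal0.
by rewrite !exprS; apply: ideal_congM.
Qed.

Lemma ideal_cong K a b : is_ideal K -> K (a - b) -> K b -> K a.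
Proof. by move=> hK hab hb; rewrite -(subrK b a); apply: idealD. Qed.

Lemma ideal_gen_ideal (S : R -> Prop) : is_ideal (ideal_gen S).
Proof.
split=> [J hJ _|a b ha hb J hJ hS|r a ha J hJ hS]; first exact: ideal0.
  by apply: idealD; [|apply: ha|apply: hb].
by apply: ideal_mulr => //; apply: ha.
Qed.

Lemma mem_ideal_gen (S : R -> Prop) a : S a -> ideal_gen S a.
Proof. by move=> ha J _; apply. Qed.

Lemma prime_ideal P : is_prime_ideal P -> is_ideal P. Proof. by case. Qed.

Lemma primeM P a b : is_prime_ideal P -> ~ P a -> ~ P b -> ~ P (a * b).
Proof. by case=> _ _ h ha hb /h []. Qed.

(** K + (f), with the coefficient of f exposed. Iterating it yields the ideals
    K + (f_1, ..., f_i) of a regular sequence one generator at a time, which is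
    the form that inductions on the sequence need. *)
Definition adj K f x := exists r, K (x - r * f).

Lemma adj_ideal K f : is_ideal K -> is_ideal (adj K f).
Proof.
move=> hK; split=> [|a b [r hr] [t ht]|c a [r hr]].
- by exists 0; rewrite mul0r subrr; apply: ideal0.
- exists (r + t); rewrite (_ : _ - _ = (a - r * f) + (b - t * f)); last by ring.
  exact: idealD.
- exists (c * r); rewrite (_ : _ - _ = c * (a - r * f)); last by ring.
  exact: ideal_mulr.
Qed.

Lemma sub_adj K f x : K x -> adj K f x.
Proof. by exists 0; rewrite mul0r subr0. Qed.

Lemma mem_adj K f : is_ideal K -> adj K f f.
Proof. by move=> hK; exists 1; rewrite mul1r subrr; apply: ideal0. Qed.

Lemma adjS K J f x : (forall y, K y -> J y) -> adj K f x -> adj J f x.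
Proof. by move=> h [r hr]; exists r; apply: h. Qed.

Lemma adj_min K J f x :
  is_ideal J -> (forall y, K y -> J y) -> J f -> adj K f x -> J x.
Proof.
move=> hJ hKJ hf [r /hKJ hr]; apply: ideal_cong hr _ => //.
exact: ideal_mulr.
Qed.

Lemma adjC K f g x : adj (adj K f) g x -> adj (adj K g) f x.
Proof. by move=> [r [t h]]; exists t, r; rewrite addrAC. Qed.

Lemma adj_cong K f g x : is_ideal K -> K (f - g) -> adj K f x -> adj K g x.
Proof.
move=> hK hfg [r hr]; exists r.
rewrite (_ : _ - _ = x - r * f + r * (f - g)); last by ring.
by apply: idealD => //; apply: ideal_mulr.
Qed.

Definition adjs K s : R -> Prop := foldl adj K s.

Lemma adjs_ideal K s : is_ideal K -> is_ideal (adjs K s).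
Proof. by elim: s K => //= f s IH K hK; apply/IH/adj_ideal. Qed.

Lemma sub_adjs K s x : K x -> adjs K s x.
Proof. by elim: s K => //= f s IH K hK; apply/IH/sub_adj. Qed.

Lemma mem_adjs K s f : is_ideal K -> f \in s -> adjs K s f.
Proof.
elim: s K => //= g s IH K hK; rewrite inE => /orP [/eqP ->|]; last first.
  by apply/IH/adj_ideal.
exact/sub_adjs/mem_adj.
Qed.

Lemma adjs_min K J s x :
    is_ideal J -> (forall y, K y -> J y) -> (forall f, f \in s -> J f) ->
  adjs K s x -> J x.
Proof.
move=> hJ; elim: s K => /= [K hK _|f s IH K hK hs]; first exact: hK.
apply: IH => [y|g gs]; last by apply: hs; rewrite inE gs orbT.
by apply: adj_min => //; apply: hs; rewrite inE eqxx.
Qed.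

Lemma ideal_add_seqE K s x : is_ideal K -> ideal_add_seq K s x <-> adjs K s x.
Proof.
move=> hK; split=> [h|]; last first.
  apply: adjs_min => [|y Ky|f fs]; first exact: ideal_gen_ideal.
    by apply: mem_ideal_gen; left.
  by apply: mem_ideal_gen; right.
apply: h; first exact: adjs_ideal.
by move=> y [Ky|ys]; [apply: sub_adjs|apply: mem_adjs].
Qed.

End Ideals.

(** The ascending chain condition, for the chain of ideals generated by longer
    and longer initial segments of a sequence of elements. *)
Definition noetherian (R : comNzRingType) : Prop :=
  forall h : nat -> R,
    exists n, ideal_gen (fun f => exists2 i, i < n & f = h i) (h n).

(** * Regular sequences, locally at a prime *)

Section LocalRegularity.
Local Open Scope ring_scope.
Variables (R : comNzRingType) (m : R -> Prop).
Hypothesis mP : is_prime_ideal m.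
Implicit Types (I J K : R -> Prop) (a b f g x u : R) (s : seq R).

(** The contraction to R of the extension of K to the localization at m. *)
Definition loc K x := exists2 u, ~ m u & K (u * x).

Lemma sub_loc K x : K x -> loc K x.
Proof. by move=> hx; exists 1; [case: mP|rewrite mul1r]. Qed.

Lemma loc_ideal K : is_ideal K -> is_ideal (loc K).
Proof.
move=> hK; split=> [|a b [u mu ha] [v mv hb]|c a [u mu ha]].
- by apply: sub_loc; apply: ideal0.
- exists (u * v); first exact: primeM.
  rewrite (_ : _ * _ = v * (u * a) + u * (v * b)); last by ring.
  by apply: idealD => //; apply: ideal_mulr.
- by exists u => //; rewrite mulrCA; apply: ideal_mulr.
Qed.

Lemma locS K J x : (forall y, K y -> J y) -> loc K x -> loc J x.
Proof. by move=> h [u mu hu]; exists u => //; apply: h. Qed.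

Lemma loc_cancel K u x : is_ideal K -> ~ m u -> loc K (u * x) -> loc K x.
Proof. by move=> hK mu [v mv h]; exists (v * u); [apply: primeM|rewrite -mulrA]. Qed.

Lemma unitD u a : ~ m u -> m a -> ~ m (u + a).
Proof.
move=> mu ma h; apply: mu; rewrite -(addrK a u).
exact: idealB (prime_ideal mP) h ma.
Qed.

(** f is a nonzerodivisor on the localization of R / K at m. *)
Definition regular K f := forall x, loc K (f * x) -> loc K x.

Fixpoint regular_seq K s : Prop :=
  if s is f :: s' then regular K f /\ regular_seq (adj K f) s' else True.

Lemma regular_ext K J f :
  (forall x, K x <-> J x) -> regular K f -> regular J f.
Proof.
move=> h hf x hx; apply: (locS (K := K)) => [y /h //|]; apply: hf.
by apply: locS hx => y /h.
Qed.

Lemma regularM K f g : regular K f -> regular K g -> regular K (f * g).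
Proof. by move=> hf hg x; rewrite -mulrA => /hf /hg. Qed.

Lemma regularX K f n : regular K f -> regular K (f ^+ n).
Proof.
move=> hf; elim: n => [|n IH]; first by move=> x; rewrite mul1r.
by rewrite exprS; apply: regularM.
Qed.

Lemma regular_unit K u : is_ideal K -> ~ m u -> regular K u.
Proof. by move=> hK mu x; apply: loc_cancel. Qed.

Lemma regular_cong K f g : is_ideal K -> K (f - g) -> regular K f -> regular K g.
Proof.
move=> hK hfg hf x hx; apply: hf; apply: ideal_cong hx; first exact: loc_ideal.
by apply: sub_loc; rewrite -mulrBl; apply: ideal_mull.
Qed.

Lemma regular_seq_cong K J s t :
    is_ideal K -> is_ideal J -> (forall x, K x <-> J x) -> size s = size t ->
    (forall i, (i < size s)%N -> K (s`_i - t`_i)) ->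
  regular_seq K s -> regular_seq J t.
Proof.
elim: s t K J => [|f s IH] [|g t] //= K J hK hJ KJ [st] hst [hf hs]; split.
  by apply: (regular_ext KJ); apply: regular_cong hf => //; apply: (hst 0%N).
apply: (IH t (adj K f)) => //; try exact: adj_ideal.
  move=> x; split=> h.
    apply: (adjS (K := K)) => [y /KJ //|].
    by apply: adj_cong h => //; apply: (hst 0%N).
  apply: (adj_cong (f := g)) => //.
    by apply: ideal_subC => //; apply: (hst 0%N).
  by apply: adjS h => y /KJ.
by move=> i hi; apply/sub_adj/(hst i.+1).
Qed.

Lemma regular_seq_rcons K s f :
  regular_seq K (rcons s f) <-> regular_seq K s /\ regular (adjs K s) f.
Proof.
elim: s K => [|g s IH] K /=; first by split; case.
by split=> [[hg /IH[? ?]]|[[? ?] ?]] //; split=> //; apply/IH.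
Qed.

(** If g x vanishes in the localization of R / K, then regularity of g modulo
    f and of f yields a chain x = x_0, x_1, ... of elements killed by g with
    x_i = f x_{i+1} up to units and modulo K. By the chain condition some x_n
    lies in the ideal generated by K and the earlier terms, that is by K and
    x_{n-1} = f x_n, so that x_n is killed by a unit 1 - c f. The chain
    condition thus replaces Nakayama's lemma. *)
Lemma regular_swapl K f g :
    noetherian R -> is_ideal K -> m f ->
  regular K f -> regular (adj K f) g -> regular K g.
Proof.
move=> noeR hK mf hf hg x hx; apply: NNPP => nx.
pose N := {y | loc K (g * y) /\ ~ loc K y}.
(* The chain is chosen among elements that survive in the localization, so
   that the unit killing some x_n is a contradiction. *)
pose next (y z : N) := exists2 u, ~ m u & K (u * proj1_sig y - proj1_sig z * f).
have step y : exists z, next y z.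
  case: y => y [gy ny].
  have [u mu [z hz]] : loc (adj K f) y by apply/hg; apply: locS gy; apply: sub_adj.
  have Kz : loc K (u * y - z * f) by apply: sub_loc.
  have Nz : loc K (g * z) /\ ~ loc K z.
    split; first apply: hf.
      apply: ideal_cong (ideal_mulr u (loc_ideal hK) gy); first exact: loc_ideal.
      rewrite (_ : _ - _ = - (g * (u * y - z * f))); last by ring.
      exact: idealN (loc_ideal hK) (ideal_mulr _ (loc_ideal hK) Kz).
    move=> lz; apply: ny; apply: loc_cancel mu _ => //.
    by apply: (ideal_cong (loc_ideal hK) Kz); apply: ideal_mull; first exact: loc_ideal.
  by exists (exist _ z Nz), u.
have [F hF] : exists F : N -> N, forall y, next y (F y).
  exists (fun y => proj1_sig (constructive_indefinite_description _ (step y))).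
  by move=> y; case: constructive_indefinite_description.
pose h n := iter n F (exist _ x (conj hx nx)).
have [[|j] hj] := noeR (fun n => proj1_sig (h n)).
  case: (h 0%N) hj => y [gy ny] /= hy; apply: ny.
  by apply: (hy (loc K)) => [|z []]; first exact: loc_ideal.
pose J := loc (adj K (proj1_sig (h j))).
have hJ : is_ideal J by apply/loc_ideal/adj_ideal.
have Jh i : (i <= j)%N -> J (proj1_sig (h i)).
  move=> ij; rewrite -(subKn ij); elim: (j - i)%N (leq_subr i j) => [_|d IH dj].
    by rewrite subn0; apply: sub_loc; apply: mem_adj.
  have [u mu hu] := hF (h (j - d.+1)%N).
  move: hu; rewrite -[F _]/(h (j - d.+1).+1) -subSn // subSS => hu.
  apply: (@loc_cancel _ u) => //; first exact: adj_ideal.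
  apply: ideal_cong (sub_loc (sub_adj _ hu)) _ => //.
  by apply: ideal_mull => //; apply: IH; apply: ltnW.
have [w mw [c hc]] : J (proj1_sig (h j.+1)).
  by apply: hj => // _ [i ij ->]; apply: Jh.
have [u mu hu] := hF (h j); rewrite -[F _]/(h j.+1) in hu.
case: (h j.+1) hc hu => y [gy ny] /= hc hu; apply: ny.
exists (w * u + - (c * f)).
  apply: unitD; first exact: primeM.
  by apply: idealN; [apply: prime_ideal|apply: ideal_mulr => //; apply: prime_ideal].
rewrite (_ : _ * y = u * (w * y - c * proj1_sig (h j))
                   + c * (u * proj1_sig (h j) - y * f)); last by ring.
by apply: idealD => //; apply: ideal_mulr.
Qed.

Lemma regular_swapr K f g :
  is_ideal K -> regular K f -> regular (adj K f) g -> regular (adj K g) f.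
Proof.
move=> hK hf hg x [u mu [y hy]].
have [v mv [w hw]] : loc (adj K f) y.
  apply: hg; apply: sub_loc; exists (u * x).
  rewrite (_ : _ - _ = - (u * (f * x) - y * g)); last by ring.
  exact: idealN.
apply: (@loc_cancel _ (v * u)); [exact: adj_ideal|exact: primeM|].
have /hf : loc K (f * (v * u * x - w * g)).
  apply: sub_loc.
  rewrite (_ : f * _ = v * (u * (f * x) - y * g) + g * (v * y - w * f)); last by ring.
  by apply: idealD => //; apply: ideal_mulr.
move=> [t mt ht]; exists t => //; exists (t * w).
by rewrite (_ : _ - _ = t * (v * u * x - w * g)); last by ring.
Qed.

Lemma regular_seq_swap K f g s :
    noetherian R -> is_ideal K -> m f ->
  regular_seq K [:: f, g & s] -> regular_seq K [:: g, f & s].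
Proof.
move=> noeR hK mf /= [hf [hg hs]]; split; first exact: regular_swapl hf hg.
split; first exact: regular_swapr.
apply: regular_seq_cong hs => //; try by do 2 apply: adj_ideal.
  by move=> x; split; apply: adjC.
by move=> i _; rewrite subrr; apply: ideal0; do 2 apply: adj_ideal.
Qed.

Lemma regular_seq_rot K f s :
    noetherian R -> is_ideal K -> m f ->
  regular_seq K (f :: s) -> regular_seq K (rcons s f).
Proof.
move=> noeR; elim: s K => [|g s IH] K hK mf // h.
have [hg hs] := regular_seq_swap noeR hK mf h.
by split=> //; apply: IH => //; apply: adj_ideal.
Qed.

Lemma regular_seq_unrot K g s :
    noetherian R -> is_ideal K -> (forall f, f \in s -> m f) ->
  regular_seq K (rcons s g) -> regular_seq K (g :: s).
Proof.
move=> noeR; elim: s K => [|f s IH] K hK ms // [hf hs].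
apply: regular_seq_swap => //; first by apply: ms; rewrite inE eqxx.
split=> //; apply: IH => //; first exact: adj_ideal.
by move=> h hh; apply: ms; rewrite inE hh orbT.
Qed.

End LocalRegularity.

(** * Exchanging an element into a regular sequence *)

Section Exchange.
Local Open Scope ring_scope.
Variable R : comNzRingType.
Implicit Types (K m : R -> Prop) (f g x : R) (s t : seq R).

(** The base-D digits of n serve as exponents; they run through all exponent
    vectors with entries below D as n runs through the integers below
    D ^ size s. *)
Fixpoint digit_monomial D s n : R :=
  if s is f :: s' then f ^+ (n %% D)%N * digit_monomial D s' (n %/ D)%N else 1.

Lemma digit_monomial_cong K D x s n :
    is_ideal K -> (0 < D)%N -> (n < D ^ size s)%N ->
    (forall i, (i < size s)%N -> K (s`_i - x ^+ (D ^ i)%N)) ->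
  K (digit_monomial D s n - x ^+ n).
Proof.
move=> hK D0; elim: s x n => [|f s IH] x n /= hn hs.
  by case: n hn => // _; rewrite subrr; apply: ideal0.
rewrite [in x ^+ n](divn_eq n D) addnC exprD mulnC exprM.
apply: ideal_congM => //; first by apply: ideal_congX => //; apply: (hs 0%N).
apply: IH => [|i hi]; first by rewrite ltn_divLR // mulnC -expnS.
by rewrite -exprM -expnS; apply: (hs i.+1).
Qed.

Lemma sum_expr_lowest (c : nat -> R) x N a :
    (a < N)%N -> (forall n, (n < a)%N -> c n = 0) ->
  exists w, \sum_(n < N) c n * x ^+ n = x ^+ a * (c a + w * x).
Proof.
move=> aN ha; exists (\sum_(n < N | (a < n)%N) c n * x ^+ (n - a.+1)%N).
rewrite (bigD1 (Ordinal aN)) //= mulrDr mulrC; congr (_ + _).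
rewrite mulr_suml mulr_sumr (bigID (fun n : 'I_N => (a < n)%N)) /=.
rewrite [X in _ + X]big1 ?addr0 => [|n /andP [na an]]; last first.
  rewrite ha ?mul0r //; rewrite -leqNgt leq_eqVlt in an.
  by case/orP: an => // /eqP E; rewrite -val_eqE /= E eqxx in na.
apply: eq_big => [n|n /andP [_ an]]; first by rewrite -val_eqE /= andbC; lia.
by rewrite -mulrA mulrCA -exprSr -exprD; congr (_ * x ^+ _); lia.
Qed.

(** The combination g of digit monomials may replace f. Modulo the elements
    t_i = s_i - f ^ (D ^ (i + 1)) the digit monomial of index n becomes f ^ n, so
    that g becomes c_a + w f, a unit, times f ^ a, where a is the least index
    with c_a nonzero. Since f is regular modulo the t_i, so is g, and a
    regular sequence may be permuted. *)
Lemma exchange m K D f s (c : nat -> R) :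
    noetherian R -> is_prime_ideal m -> is_ideal K -> (0 < D)%N ->
    (forall g, g \in f :: s -> m g) -> regular_seq m K (f :: s) ->
    (forall n, c n = 0 \/ ~ m (c n)) ->
    (exists2 n, (n < D ^ (size s).+1)%N & c n != 0) ->
  exists2 t, size t = size s /\ (forall g, g \in t -> m g) &
    regular_seq m K
      (\sum_(n < D ^ (size s).+1) c n * digit_monomial D (f :: s) n :: t).
Proof.
move=> noeR mP hK D0 ms hs hc c0.
have mI := prime_ideal mP.
have mf : m f by apply: ms; rewrite inE eqxx.
pose t := mkseq (fun i => s`_i - f ^+ (D ^ i.+1)%N) (size s).
have st : size t = size s by rewrite size_mkseq.
have mfX i : m (f ^+ (D ^ i.+1)%N).
  by rewrite -(prednK (n := (D ^ i.+1)%N)) ?expn_gt0 ?D0 // exprS; apply: ideal_mull.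
have mt g : g \in t -> m g.
  case/mapP => i; rewrite mem_iota add0n => /andP [_ hi] ->.
  apply: idealB => //; apply: ms; rewrite inE mem_nth ?orbT //.
exists t => //.
have : regular_seq m K (f :: t).
  case: hs => hf hs; split=> //.
  apply: regular_seq_cong hs => //; try exact: adj_ideal.
  move=> i hi; rewrite nth_mkseq // opprB addrC subrK.
  rewrite -(prednK (n := (D ^ i.+1)%N)) ?expn_gt0 ?D0 // exprSr.
  by apply: ideal_mulr; [apply: adj_ideal|apply: mem_adj].
move/(regular_seq_rot mP noeR hK mf)/regular_seq_rcons => [ht hf].
apply: regular_seq_unrot => //; apply/regular_seq_rcons; split=> //.
have hJ : is_ideal (adjs K t) by apply: adjs_ideal.
have [a /andP [aN ca] amin] : {a | (a < D ^ (size s).+1)%N && (c a != 0) &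
    forall n, (n < D ^ (size s).+1)%N && (c n != 0) -> (a <= n)%N}.
  have c0' : exists n, (n < D ^ (size s).+1)%N && (c n != 0).
    by case: c0 => n ? ?; exists n; apply/andP.
  by case: (ex_minnP c0') => a ? ?; exists a.
have [n na|w hw] := sum_expr_lowest (c := c) f aN.
  apply/eqP; apply/negPn/negP => cn.
  by have := amin n; rewrite cn (ltn_trans na aN) leqNgt na => /(_ isT).
have mu : ~ m (c a + w * f).
  apply: unitD => //; last exact: ideal_mulr.
  by case: (hc a) => // E; rewrite E eqxx in ca.
apply: (@regular_cong _ _ _ _ (f ^+ a * (c a + w * f))) => //.
  rewrite -hw -sumrB; apply: ideal_sum => // n _; rewrite -mulrBr.
  apply: ideal_mulr => //; apply: ideal_subC => //.
  apply: digit_monomial_cong => // -[_|i hi] /=.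
    by rewrite expr1 subrr; apply: ideal0.
  have := mem_adjs hK (mem_nth 0 (_ : (i < size t)%N)); rewrite st nth_mkseq //.
  exact.
apply: regularM; first exact: regularX.
exact: regular_unit.
Qed.

End Exchange.

(** * Polynomial rings over a field are Noetherian *)

Section Dickson.

Lemma min_tail (v : nat -> nat) N :
  exists2 p, N <= p & forall q, N <= q -> v p <= v q.
Proof.
suff H b q : v q <= b -> N <= q ->
    exists2 p, N <= p & forall q, N <= q -> v p <= v q.
  exact: (H (v N) N).
elim: b q => [|b IH] q vq Nq.
  by exists q => // q' _; apply: leq_trans vq _.
have [h|h] := classic (forall q', N <= q' -> v q <= v q'); first by exists q.
have [q' h'] := not_all_ex_not _ _ h.
have [Nq' /negP] := imply_to_and _ _ h'; rewrite -ltnNge => vq'.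
by apply: (IH q') => //; rewrite -ltnS (leq_trans vq').
Qed.

Lemma nondecreasing_subseq (v : nat -> nat) :
  exists2 phi : nat -> nat, (forall i j, i < j -> phi i < phi j)
    & forall i j, i < j -> v (phi i) <= v (phi j).
Proof.
have [p hp] : exists p : nat -> nat, forall N,
    N <= p N /\ forall q, N <= q -> v (p N) <= v q.
  have h N : exists p, N <= p /\ forall q, N <= q -> v p <= v q.
    by have [p ? ?] := min_tail v N; exists p.
  exists (fun N => proj1_sig (constructive_indefinite_description _ (h N))).
  by move=> N; case: constructive_indefinite_description.
pose phi := fix phi i := if i is j.+1 then p (phi j).+1 else p 0.
have phiS i : phi i < phi i.+1 by have [] := hp (phi i).+1.
have phi_lt i j : i < j -> phi i < phi j.
  elim: j => // j IH; rewrite ltnS leq_eqVlt => /orP [/eqP ->|/IH] //.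
  by move=> h; apply: ltn_trans h _.
exists phi => // i j ij; have {ij} := phi_lt i j ij.
case: i => [|i] h; first by have [_] := hp 0; apply.
have [le_p] := hp (phi i).+1; apply.
by apply: leq_trans (ltnW h).
Qed.

(** Passing to a subsequence once for each coordinate makes all coordinates
    nondecreasing. *)
Lemma dickson n (u : nat -> 'X_{1..n}) :
  exists i j, i < j /\ (u i <= u j)%MM.
Proof.
suff H k : exists2 phi : nat -> nat, (forall i j, i < j -> phi i < phi j)
    & forall c : 'I_n, c < k -> forall i j, i < j -> u (phi i) c <= u (phi j) c.
  have [phi phi_lt phi_le] := H n.
  exists (phi 0), (phi 1); split; first exact: phi_lt.
  by apply/mnm_lepP => c; apply: phi_le.
elim: k => [|k [phi phi_lt phi_le]]; first by exists id.
have [kn|nk] := ltnP k n; last first.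
  by exists phi => // c _; apply: phi_le; apply: leq_trans nk.
have [psi psi_lt psi_le] := nondecreasing_subseq (fun i => u (phi i) (Ordinal kn)).
exists (phi \o psi) => [i j ij|c]; first exact/phi_lt/psi_lt.
rewrite ltnS leq_eqVlt => /orP [/eqP ck|ck] i j ij /=.
  by rewrite (_ : c = Ordinal kn); [apply: psi_le|apply: val_inj].
by apply: phi_le => //; apply: psi_lt.
Qed.

End Dickson.

Section HilbertBasis.
Local Open Scope ring_scope.
Variables (k : fieldType) (n : nat).
Implicit Types (f g : {mpoly k[n]}).

Lemma mlead_sub_lt f g :
    mlead f = mlead g -> mleadc f = mleadc g -> f - g != 0 ->
  (mlead (f - g) < mlead f)%O.
Proof.
move=> hl hc nz; rewrite lt_neqAle; apply/andP; split; last first.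
  by have := mleadB_le f g; rewrite hl joinxx.
apply: contraNneq nz => E; rewrite -mleadc_eq0 E mcoeffB hc hl subrr //.
Qed.

(** With J_i the ideal generated by the first i terms of a sequence that never
    falls into them, let g_i have a smallest possible leading monomial among
    the elements of J_{i+1} outside J_i. Among these monomials one divides a
    later one, and cancelling the leading term of the later g_j by the earlier
    g_i contradicts minimality. *)
Theorem mpoly_noetherian : noetherian {mpoly k[n]}.
Proof.
move=> h; apply: NNPP => nh.
pose J i := ideal_gen (fun f => exists2 j, (j < i)%N & f = h j).
have hJ i : is_ideal (J i) by apply: ideal_gen_ideal.
have JS i j f : (i <= j)%N -> J i f -> J j f.
  move=> ij; apply=> // _ [l li ->]; apply: mem_ideal_gen.
  by exists l => //; apply: leq_trans ij.
pose Q i f := J i.+1 f /\ ~ J i f.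
have minQ i : exists f, Q i f /\ forall g, Q i g -> ~ (mlead g < mlead f)%O.
  have Qh : Q i (h i).
    split; first by apply: mem_ideal_gen; exists i.
    by move=> hi; apply: nh; exists i.
  apply: NNPP => nmin.
  suff H m : forall f, mlead f = m -> ~ Q i f by apply: (H _ (h i)).
  elim/(@ltmwf n): m => m IH f fm Qf; apply: nmin; exists f; split=> // g Qg.
  by rewrite fm => /IH /(_ g erefl).
have [g hg] : exists g : nat -> {mpoly k[n]}, forall i,
    Q i (g i) /\ forall f, Q i f -> ~ (mlead f < mlead (g i))%O.
  exists (fun i => proj1_sig (constructive_indefinite_description _ (minQ i))).
  by move=> i; case: constructive_indefinite_description.
have [i [j [ij le_ij]]] := dickson (fun i => mlead (g i)).
have [[Jj nJj] minj] := hg j; have [[Ji _] _] := hg i.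
have gN0 l : g l != 0.
  by apply/eqP => E; have [[_ nJl] _] := hg l; apply: nJl; rewrite E; apply: ideal0.
pose c := mleadc (g j) / mleadc (g i).
have cN0 : c != 0 by rewrite mulf_neq0 ?invr_eq0 ?mleadc_eq0.
pose q := (c *: 'X_[mlead (g j) - mlead (g i)]) * g i.
have XN0 (m : 'X_{1..n}) : 'X_[m] != 0 :> {mpoly k[n]}.
  by rewrite -mleadc_eq0 mleadXm mcoeffX eqxx oner_neq0.
have Jq : J j q by apply: (ideal_mulr _ (hJ j)); apply: JS Ji.
have Qq : Q j (g j - q).
  split; first by apply: (idealB (hJ _)); [exact: Jj|apply: JS Jq].
  by move=> hq; apply: nJj; rewrite -(subrK q (g j)); apply: (idealD (hJ _)).
apply: (minj _ Qq); apply: mlead_sub_lt.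
- by rewrite /q mleadM ?mleadZ ?mleadXm ?submK // scaler_eq0 negb_or cN0 XN0.
- have E : mlead q = mlead (g j).
    by rewrite /q mleadM ?mleadZ ?mleadXm ?submK // scaler_eq0 negb_or cN0 XN0.
  have := mcoeffMX (g i) (mlead (g j) - mlead (g i)) (mlead (g i)).
  rewrite submK // E /q -scalerAl mcoeffZ ['X_[_] * _]mulrC => ->.
  by rewrite divfK // mleadc_eq0.
- by apply/eqP => E; have [_ nJq] := Qq; apply: nJq; rewrite E; apply: ideal0.
Qed.

End HilbertBasis.

(** * Ideals generated by variables *)

Section VariableIdeals.
Local Open Scope ring_scope.
Variables (k : fieldType) (n : nat).
Implicit Types (W F : {set 'I_n}) (p q : {mpoly k[n]}).

Definition var_ideal W : {mpoly k[n]} -> Prop :=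
  ideal_gen (fun p => exists2 i, i \in W & p = 'X_i).

(** The substitution whose kernel is the ideal of the variables in W; that the
    ideal is prime follows because polynomials form a domain. *)
Definition kill W : {mpoly k[n]} -> {mpoly k[n]} :=
  mmap (@mpolyC n k) (fun i => if i \in W then 0 else 'X_i).

HB.instance Definition _ W := GRing.RMorphism.on (kill W).

Lemma var_ideal_ideal W : is_ideal (var_ideal W).
Proof. exact: ideal_gen_ideal. Qed.

Lemma var_idealX W i : i \in W -> var_ideal W 'X_i.
Proof. by move=> iW; apply: mem_ideal_gen; exists i. Qed.

Lemma var_idealS W F p : W \subset F -> var_ideal W p -> var_ideal F p.
Proof.
move=> /subsetP WF; apply=> [|_ [i iW ->]]; first exact: var_ideal_ideal.
by apply: var_idealX; apply: WF.
Qed.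

Lemma killX W i : kill W 'X_i = if i \in W then 0 else 'X_i.
Proof. by rewrite /kill mmapX mmap1U. Qed.

Lemma kill_cong W p : var_ideal W (p - kill W p).
Proof.
have hW := var_ideal_ideal W; have h0 := ideal0 hW.
elim/mpolyind: p => [|c m p _ _ IH]; first by rewrite rmorph0 subrr; exact: h0.
rewrite rmorphD /= opprD addrACA; apply: (idealD hW) => //.
rewrite /kill mmapZ mmapX -mul_mpolyC -mulrBr; apply: (ideal_mulr _ hW) => //.
rewrite mpolyXE_id /mmap1.
elim/big_ind2: _ => [|? ? ? ? ? ?|i _]; first by rewrite subrr; exact: h0.
  exact: (ideal_congM hW).
apply: (ideal_congX _ hW) => //; case: ifP => iW; last by rewrite subrr; exact: h0.
by rewrite subr0; apply: var_idealX.
Qed.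

Lemma var_idealE W p : var_ideal W p <-> kill W p = 0.
Proof.
split=> [h|h]; last by have := @kill_cong W p; rewrite h subr0.
apply: (h (fun p => kill W p = 0)) => [|_ [i iW ->]]; last by rewrite killX iW.
split=> [|a b ha hb|a b hb]; first by rewrite rmorph0.
  by rewrite rmorphD /= ha hb addr0.
by rewrite rmorphM /= hb mulr0.
Qed.

Lemma var_ideal_prime W : is_prime_ideal (var_ideal W).
Proof.
split=> [||a b]; first exact: var_ideal_ideal.
  by rewrite var_idealE rmorph1 => /eqP; rewrite oner_eq0.
rewrite !var_idealE rmorphM /= => /eqP; rewrite mulf_eq0.
by case/orP => /eqP; [left|right].
Qed.

Lemma var_idealXN W i : i \notin W -> ~ var_ideal W 'X_i.
Proof.
move=> iW; rewrite var_idealE killX (negbTE iW) => /(congr1 (mcoeff U_(i))).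
by move/eqP; rewrite mcoeffX eqxx mcoeff0 oner_eq0.
Qed.

Lemma var_idealCN W (c : k) : c != 0 -> ~ var_ideal W c%:MP.
Proof.
by move=> c0; rewrite var_idealE /kill mmapC => /eqP; rewrite mpolyC_eq0 (negPf c0).
Qed.

Lemma var_ideal_coef W p :
    (forall m : 'X_{1..n}, (forall i, i \in W -> m i = 0%N) -> p@_m = 0) ->
  var_ideal W p.
Proof.
have hW := var_ideal_ideal W; move=> hp.
rewrite (mpolyE p) big_seq; apply: (ideal_sum _ hW) => m mp.
rewrite -mul_mpolyC; apply: (ideal_mulr _ hW).
have [i iW mi] : exists2 i, i \in W & m i != 0%N.
  apply: NNPP => hi; move: mp; rewrite mcoeff_msupp hp ?eqxx // => i iW.
  by apply/eqP/negPn/negP => mi; apply: hi; exists i.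
rewrite mpolyXE_id (bigD1 i) //= -(prednK (n := m i)) ?lt0n // exprS -mulrA.
by apply: (ideal_mull _ hW); apply: var_idealX.
Qed.

Lemma var_idealU W F p :
  var_ideal (W :|: F) p -> exists2 q, var_ideal W q & var_ideal F (p - q).
Proof.
have hW := var_ideal_ideal W; have hF := var_ideal_ideal F.
have [W0 F0] := (ideal0 hW, ideal0 hF).
move/(_ (fun p => exists2 q, var_ideal W q & var_ideal F (p - q))).
apply=> [|_ [i + ->]]; last first.
  case/setUP => hi; first by exists 'X_i; [apply: var_idealX|rewrite subrr].
  by exists 0; rewrite ?subr0 //; apply: var_idealX.
split=> [|a b [q hq ha] [r hr hb]|a b [q hq hb]].
- by exists 0; rewrite ?subr0.
- exists (q + r); first exact: (idealD hW).
  by rewrite opprD addrACA; apply: (idealD hF).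
- exists (a * q); first exact: (ideal_mulr _ hW).
  by rewrite -mulrBr; apply: (ideal_mulr _ hF).
Qed.

(** [msize] is one more than the degree, and 0 at the zero polynomial. *)
Definition deg_le d p := (msize p <= d.+1)%N.

Lemma deg_leM d e p q : deg_le d p -> deg_le e q -> deg_le (d + e)%N (p * q).
Proof.
rewrite /deg_le; have [->|p0] := eqVneq p 0; first by rewrite mul0r msize0.
have [->|q0] := eqVneq q 0; first by rewrite mulr0 msize0.
rewrite msizeM // => hp hq; rewrite -ltnS prednK ?ltnS; last first.
  by rewrite addn_gt0 lt0n msize_poly_eq0 p0.
by rewrite -addnS -addSn leq_add.
Qed.

Lemma deg_leX d p i : deg_le d p -> deg_le (i * d)%N (p ^+ i).
Proof.
move=> hp; elim: i => [|i IH]; first by rewrite /deg_le expr0 msize1.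
by rewrite exprS mulSn; apply: deg_leM.
Qed.

Lemma deg_leS d e p : (d <= e)%N -> deg_le d p -> deg_le e p.
Proof. by move=> de hp; apply: leq_trans hp _. Qed.

Lemma deg_le_digit_monomial D d (s : seq {mpoly k[n]}) i :
    (0 < D)%N -> (forall p, p \in s -> deg_le d p) ->
  deg_le (size s * D * d)%N (digit_monomial D s i).
Proof.
move=> D0; elim: s i => [|p s IH] i hs /=; first by rewrite /deg_le msize1.
rewrite mulSn mulnDl; apply: deg_leM.
  apply: (@deg_leS ((i %% D) * d)%N); last by apply/deg_leX/hs; rewrite inE eqxx.
  by rewrite leq_mul2r ltnW ?orbT // ltn_pmod.
by apply: IH => q qs; apply: hs; rewrite inE qs orbT.
Qed.

Lemma coef_deg_le d p (m : 'X_{1..n}) i : deg_le d p -> (d < m i)%N -> p@_m = 0.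
Proof.
move=> hp hi; apply: memN_msupp_eq0; apply: msize_mdeg_ge.
apply: leq_trans hp _; apply: leq_trans hi _.
by rewrite mdegE (bigD1 i) //= leq_addr.
Qed.

(** More polynomials than there are variables in F satisfy an algebraic
    relation modulo the other variables: the D ^ size s digit monomials have
    degree O(D), so modulo these variables they lie in a space of dimension
    O(D ^ #|F|). *)
Lemma digit_monomial_dependence F (s : seq {mpoly k[n]}) :
    (#|F| < size s)%N ->
  exists D (c : nat -> k),
    [/\ (0 < D)%N, exists2 i, (i < D ^ size s)%N & c i != 0
      & var_ideal (~: F)
          (\sum_(i < D ^ size s) (c i)%:MP * digit_monomial D s i)].
Proof.
move=> Fs; pose r := size s; pose d := (\max_(p <- s) msize p)%N.
have hd p : p \in s -> deg_le d p.
  by move=> ps; rewrite /deg_le leqW // /d (big_rem p) //= leq_maxl.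
(* B bounds the exponents in the digit monomials, and D exceeds C ^ #|F| in
   order that B ^ #|F| <= (C * D) ^ #|F| < D ^ #|F|.+1 <= D ^ r. *)
pose C := (r * d)%N.+1; pose D := (C ^ #|F|)%N.+1; pose B := (r * D * d)%N.+1.
have BD : (B ^ #|F| < D ^ r)%N.
  apply: (@leq_ltn_trans ((C * D) ^ #|F|)%N).
    have BC : (B <= C * D)%N by rewrite /B /C mulSn mulnAC addSn ltnS leq_addl.
    by case: #|F| => [|l]; rewrite ?expn0 // leq_exp2r.
  rewrite expnMn; apply: (@leq_trans (D ^ #|F|.+1)%N).
    by rewrite expnS ltn_pmul2r ?expn_gt0.
  by rewrite leq_pexp2l.
(* The columns of M are the monomials in the variables of F with exponents
   below B; a vector in the left kernel of M is a relation modulo the other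
   variables. *)
pose A := [set al : {ffun 'I_n -> 'I_B} | al \in pffun_on ord0 F predT].
pose mon (j : 'I_#|A|) : 'X_{1..n} :=
  [multinom (enum_val j : {ffun 'I_n -> 'I_B}) i | i < n].
have cardA : #|A| = (B ^ #|F|)%N by rewrite cardsE card_pffun_on card_ord.
pose M := \matrix_(i < D ^ r, j < #|A|) (digit_monomial D s i)@_(mon j).
have : kermx M != 0.
  rewrite kermx_eq0 /row_free neq_ltn; apply/orP; left.
  by apply: leq_ltn_trans (rank_leq_col M) _; rewrite cardA.
case/rowV0Pn => v /sub_kermxP vM v0.
exists D, (fun i => oapp (v 0) 0 (insub i)); split=> //.
  case/rV0Pn: v0 => i vi; exists i => //.
  by rewrite valK.
apply: var_ideal_coef => m mF; rewrite raddf_sum /=.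
have [mB|/not_all_ex_not [i im]] := classic (forall i, (m i < B)%N); last first.
  rewrite big1 // => j _; rewrite mcoeffCM (@coef_deg_le (r * D * d)%N _ m i) ?mulr0 //.
    exact: deg_le_digit_monomial.
  by rewrite ltnNge; apply/negP.
have aA : [ffun i => inord (m i)] \in A.
  rewrite inE; apply/pffun_onP; split=> // ; apply/supportP => i iF.
  by rewrite ffunE mF ?inE //; apply: val_inj; rewrite /= inordK.
have := congr1 (fun w : 'rV_#|A| => w 0 (enum_rank_in aA [ffun i => inord (m i)])) vM.
rewrite !mxE => vM0; rewrite -[RHS]vM0; apply: eq_bigr => j _.
rewrite mcoeffCM valK /= mxE; congr (_ * _).
congr (mcoeff _ _).
apply/mnmP => i; rewrite mnmE enum_rankK_in // ffunE inordK //.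
Qed.

End VariableIdeals.

(** * Regular sequences modulo an edge ideal *)

Section NoRegularPair.
Local Open Scope ring_scope.
Variables (R : comNzRingType) (m I P Q S : R -> Prop) (e : R).
Hypotheses (mP : is_prime_ideal m) (hI : is_ideal I) (hP : is_prime_ideal P).
Hypotheses (hQ : is_prime_ideal Q) (hS : is_prime_ideal S).
Hypotheses (IP : subideal I P) (IQ : subideal I Q).
Hypotheses (PS : subideal P S) (QS : subideal Q S) (Sm : subideal S m).
Hypothesis S_sum : forall x, S x -> exists2 p, P p & Q (x - p).
Hypothesis (Se : ~ S e).
Hypothesis ePQ : forall p q, P p -> Q q -> I (e * (p * q)).
Hypothesis PnQ : ~ subideal P Q.
Hypothesis QnP : ~ subideal Q P.

(** With g_i = p_i + q_i, the products g_2 (e p_1) and g_1 (e p_2) agree modulo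
    e P Q, so that e p_1 is locally a multiple z g_1 modulo I. Comparing modulo P
    and modulo Q forces z to vanish on one side and to equal e, up to a unit,
    on the other, which is impossible on S = P + Q.
    Behind this stands the assignment p + q |-> e p from S to R / I: a
    homomorphism on S that is no multiplication by an element of R / I is a
    nonzero class in Ext^1(R / S, R / I), and Ext^1 vanishes once S contains a
    regular pair. *)
Lemma no_regular_pair g1 g2 :
  S g1 -> S g2 -> regular m I g1 -> regular m (adj I g1) g2 -> False.
Proof.
have [iP iQ] := (prime_ideal hP, prime_ideal hQ).
move=> S1 S2 r1 r2.
(* An element g1 of P would be a zerodivisor: it kills e b for b in Q. *)
have nP : ~ P g1.
  move=> P1; apply: QnP => b Qb; apply: NNPP => Pb.
  have [u mu hu] : loc m I (e * b).
    by apply/r1/(sub_loc mP); rewrite mulrCA; apply: ePQ.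
  suff : ~ P (u * (e * b)) by apply; apply: IP.
  apply: primeM => //; first by move/PS/Sm.
  by apply: primeM => // /PS.
have nQ : ~ Q g1.
  move=> Q1; apply: PnQ => a Pa; apply: NNPP => Qa.
  have [u mu hu] : loc m I (e * a).
    by apply/r1/(sub_loc mP); rewrite mulrCA [g1 * a]mulrC; apply: ePQ.
  suff : ~ Q (u * (e * a)) by apply; apply: IQ.
  apply: primeM => //; first by move/QS/Sm.
  by apply: primeM => // /QS.
have [a1 Pa1 Qb1] := S_sum S1; have [a2 Pa2 Qb2] := S_sum S2.
have [u mu [z hz]] : loc m (adj I g1) (e * a1).
  apply/r2/(sub_loc mP); exists (e * a2).
  rewrite (_ : _ - _ = e * (a1 * (g2 - a2)) - e * (a2 * (g1 - a1))); last by ring.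
  by apply: (idealB hI); apply: ePQ.
have Pz : P z.
  have : P (z * g1).
    apply: (ideal_cong iP (b := u * (e * a1))).
      by apply: (ideal_subC iP); apply: IP.
    by do 2 apply: (ideal_mulr _ iP).
  by case: hP => _ _ /[apply] -[].
have Qez : Q (u * e - z).
  have : Q ((u * e - z) * a1).
    rewrite (_ : _ * _ = u * (e * a1) - z * g1 + z * (g1 - a1)); last by ring.
    by apply: (idealD iQ); [apply: IQ|apply: (ideal_mulr _ iQ)].
  case: (hQ) => _ _ /[apply] -[] // Qa1; case: nQ.
  by rewrite -(subrK a1 g1); apply: (idealD iQ).
have : ~ S (u * e) by apply: primeM => // /Sm.
apply; rewrite -(subrK z (u * e)); apply: (idealD (prime_ideal hS)).
  exact: QS.
exact: PS.
Qed.

End NoRegularPair.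

Section RegularSequences.
Local Open Scope ring_scope.

Lemma regular_seq_of_quot (R : comNzRingType) (m I : R -> Prop) s :
    is_ideal I -> regular_seq_quot I s -> regular_seq m I s.
Proof.
move=> hI [h _]; elim: s I hI h => //= f s IH I hI h; split.
  move=> x [u mu hu]; exists u => //.
  by have := h 0%N isT (u * x); rewrite !ideal_add_seqE //= mulrCA; apply.
apply: IH => [|i hi g]; first exact: adj_ideal.
rewrite !ideal_add_seqE; try exact: adj_ideal.
by have := h i.+1 hi g; rewrite !ideal_add_seqE.
Qed.

Variables (k : fieldType) (n : nat).
Implicit Types (F : {set 'I_n}) (K : {mpoly k[n]} -> Prop) (s : seq {mpoly k[n]}).
Let m : {mpoly k[n]} -> Prop := var_ideal [set: 'I_n].

(** One term of a regular sequence can be traded for an element of the prime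
    generated by the variables outside F, as long as the sequence has more terms
    than F has elements. *)
Lemma exchange_var_ideal F K s :
    is_ideal K -> (#|F| < size s)%N -> (forall f, f \in s -> m f) ->
    regular_seq m K s ->
  exists g t, [/\ size s = (size t).+1, forall f, f \in t -> m f,
                  var_ideal (~: F) g & regular_seq m K (g :: t)].
Proof.
move=> hK Fs ms hs; have [D [c [D0 c0 hg]]] := digit_monomial_dependence Fs.
case: s Fs ms hs c0 hg => [|f s] // Fs ms hs [i iD ci] hg.
have [||t [st mt] ht] := exchange (c := fun i => (c i)%:MP) (@mpoly_noetherian k n)
   (var_ideal_prime k [set: 'I_n]) hK D0 ms hs.
- move=> j; have [->|cj] := eqVneq (c j) 0; first by left.
  by right; apply: var_idealCN.
- by exists i => //; rewrite mpolyC_eq0.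
by exists (\sum_(i < D ^ (size s).+1) (c i)%:MP * digit_monomial D (f :: s) i), t;
  split=> //=; rewrite st.
Qed.

(** An elementary form of the inequality depth M <= depth M_p + dim R / p for
    the prime p generated by the variables outside F: if M = R / K has depth at
    least #|F| + 2, then p contains a regular pair. *)
Lemma regular_pair F K s :
    is_ideal K -> (#|F| + 2 <= size s)%N -> (forall f, f \in s -> m f) ->
    regular_seq m K s ->
  exists g1 g2, [/\ var_ideal (~: F) g1, var_ideal (~: F) g2,
                    regular m K g1 & regular m (adj K g1) g2].
Proof.
move=> hK Fs ms hs.
have [|g1 [t [st mt Fg1 [r1 ht]]]] := @exchange_var_ideal F K s hK _ ms hs.
  by apply: leq_trans Fs; rewrite addn2.
have [||g2 [t' [_ _ Fg2 [r2 _]]]] := @exchange_var_ideal F (adj K g1) t _ _ mt ht.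
- exact: adj_ideal.
- by move: Fs; rewrite st addn2 ltnS.
by exists g1, g2.
Qed.

End RegularSequences.

(** * Edge ideals of bipartite graphs *)

Section EdgeIdeals.
Variables (k : fieldType) (T : finType) (e : rel T).
Implicit Types (C V W : {set T}) (v w : T).

Definition indices W : {set 'I_#|T|} := [set enum_rank v | v in W].

Lemma mem_indices W v : (enum_rank v \in indices W) = (v \in W).
Proof. by rewrite mem_imset //; apply: enum_rank_inj. Qed.

Definition vertex_ideal W : {mpoly k[#|T|]} -> Prop := var_ideal (indices W).

Lemma vertex_ideal_prime W : is_prime_ideal (vertex_ideal W).
Proof. exact: var_ideal_prime. Qed.

Lemma mem_vertex_ideal W v : v \in W -> vertex_ideal W (vertex_var k v).
Proof. by move=> vW; apply: var_idealX; rewrite mem_indices. Qed.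

Lemma vertex_var_notin W v : v \notin W -> ~ vertex_ideal W (vertex_var k v).
Proof. by move=> vW; apply: var_idealXN; rewrite mem_indices. Qed.

Lemma vertex_idealS W V : W \subset V -> subideal (vertex_ideal W) (vertex_ideal V).
Proof. by move=> WV f; apply: var_idealS; apply: imsetS. Qed.

Lemma edge_ideal_sub_cover W :
    (forall u v, e u v -> (u \in W) || (v \in W)) ->
  subideal (edge_ideal (k := k) e) (vertex_ideal W).
Proof.
move=> hW f; apply=> [|_ [u [v [uv ->]]]];
  first exact: prime_ideal (vertex_ideal_prime W).
have iW := prime_ideal (vertex_ideal_prime W).
case/orP: (hW u v uv) => h; first by apply: (ideal_mull _ iW); apply: mem_vertex_ideal.
by apply: (ideal_mulr _ iW); apply: mem_vertex_ideal.
Qed.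

Lemma mul_vertex_ideals (I : {mpoly k[#|T|]} -> Prop) W V c :
    is_ideal I ->
    (forall w v, w \in W -> v \in V -> I (c * (vertex_var k w * vertex_var k v))%R) ->
  forall p q, vertex_ideal W p -> vertex_ideal V q -> I (c * (p * q))%R.
Proof.
move=> hI h p q hp hq.
have colon (d : {mpoly k[#|T|]}) : is_ideal (fun x => I (d * x)%R).
  split=> [|a b ha hb|r a ha]; first by rewrite mulr0; apply: ideal0.
    by rewrite mulrDr; apply: (idealD hI).
  by rewrite mulrCA; apply: (ideal_mulr _ hI).
have hp' w : w \in W -> I (c * (vertex_var k w * q))%R.
  move=> wW; rewrite mulrA; apply: (hq (fun x => I ((c * vertex_var k w) * x)%R)).
    exact: colon.
  by move=> _ [_ /imsetP [v vV ->] ->]; rewrite -mulrA; apply: h.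
rewrite [(p * q)%R]mulrC mulrA; apply: (hp (fun x => I ((c * q) * x)%R)).
  exact: colon.
by move=> _ [_ /imsetP [w wW ->] ->]; rewrite -mulrA [(q * _)%R]mulrC; apply: hp'.
Qed.

(** The primes generated by a cover and by more and more of the remaining
    vertices, added one at a time, all contain the edge ideal. *)
Lemma card_setC_cover_le_dim C d :
    (forall u v, e u v -> (u \in C) || (v \in C)) ->
    krull_dim_quot (edge_ideal (k := k) e) d ->
  #|~: C| <= d.
Proof.
move=> hC [_ hd]; apply: hd.
pose W i := C :|: [set v in take i (enum (~: C))].
exists (fun i => vertex_ideal (W i)); split=> [i _|i]; last rewrite cardE => hi.
  split; first exact: vertex_ideal_prime.
  move=> f /(edge_ideal_sub_cover hC); apply: vertex_idealS.
  exact: subsetUl.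
have [v0 _] : exists v, v \in enum (~: C).
  by case: (enum _) hi => // v r _; exists v; rewrite inE eqxx.
pose v := nth v0 (enum (~: C)) i.
have WS : W i.+1 = v |: W i.
  by apply/setP => w; rewrite !inE (take_nth v0) // mem_rcons inE orbCA.
split; first by rewrite WS; apply: vertex_idealS; apply: subsetUr.
move/(_ (vertex_var k v)); rewrite WS => /(_ (mem_vertex_ideal (setU11 _ _))).
apply: vertex_var_notin; rewrite !inE negb_or.
have vC : v \in enum (~: C) by apply: mem_nth.
move: (vC); rewrite mem_enum inE => -> /=; apply/negP => vi.
have := enum_uniq (~: C); rewrite -(cat_take_drop i (enum _)) cat_uniq.
case/and3P => _ /hasPn /(_ v) + _; rewrite vi; move/implyP; rewrite implybF.
by rewrite (drop_nth v0) // inE eqxx.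
Qed.

End EdgeIdeals.

Theorem theorem2p3 (k : fieldType) (T : finType) (e : rel T)
    (V1 V2 : {set T})
    (hG : simple_graph e)
    (hiso : forall v : T, 0 < degree e v)
    (hbip : bipartition e V1 V2)
    (haCM : almost_cohen_macaulay k e)
    (hpos : exists v : T, 0 < degree e v) :
  exists v : T, v \in V1 :|: V2 /\ degree e v <= 2.
Proof.
have [eC _] := hG; have [V12 V120 eV] := hbip.
have V2C : ~: V2 = V1.
  apply/setP => v; rewrite inE; move/setP/(_ v): V12; move/setP/(_ v): V120.
  by rewrite !inE; case: (v \in V1); case: (v \in V2).
have e2 u v : e u v -> (u \in V1) = (v \in V2).
  by move=> /eV; rewrite -V2C !inE => -[] [];
    case: (u \in V2); case: (v \in V2).
have [y0 y0V2] : exists y, y \in V2.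
  have [v] := hpos; rewrite card_gt0 => /set0Pn [w]; rewrite inE => /eV.
  by case=> -[]; [exists w|exists v].
have [y yV2 ymin] : exists2 y, y \in V2 & forall w, w \in V2 -> degree e y <= degree e w.
  by have [y yV2 ymin] := arg_minnP (degree e) y0V2; exists y.
exists y; rewrite inE yV2 orbT; split=> //; rewrite leqNgt; apply/negP => deg3.
have [dep [dim [[[s [ss ms hs] _] hdim dd]]]] := haCM.
pose A := [set w | e y w].
have AV1 : A \subset V1.
  by apply/subsetP => w; rewrite inE eC => /e2 ->.
pose F := V1 :\: A; pose NF := [set w | [exists v in F, e v w]].
have NFV2 : NF \subset V2.
  apply/subsetP => w; rewrite inE => /exists_inP [v]; rewrite inE => /andP [_ vV1].
  by move/e2 <-.
(* The vertices of V2 outside NF are adjacent to vertices of A only, hence by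
   minimality of the degree of y to all of them. *)
have AB a b : a \in A -> b \in V2 -> b \notin NF -> e a b.
  move=> aA bV2 bNF; suff : [set w | e b w] = A by move/setP/(_ a); rewrite aA inE eC.
  apply/eqP; rewrite eqEcard [#|A| <= _]ymin // andbT; apply/subsetP => w.
  rewrite inE => bw; apply: contraNT bNF => wA; rewrite inE; apply/exists_inP.
  by exists w; rewrite 1?eC // inE wA -V2C inE -(e2 _ _ bw) -V2C inE bV2.
have dimV1 : #|V1| <= dim.
  rewrite -V2C; apply: card_setC_cover_le_dim hdim => u v /eV.
  by case=> -[hu hv]; rewrite ?hu ?hv ?orbT.
have cardF : #|F| + 2 <= size s.
  have := cardsD V1 A; rewrite -/F (setIidPr AV1) -[#|A|]/(degree e y).
  move: deg3 dd dimV1 (subset_leq_card AV1); rewrite ss -[#|A|]/(degree e y).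
  lia.
pose I := edge_ideal (k := k) e.
have hI : is_ideal I by apply: ideal_gen_ideal.
have ms' f : f \in s -> vertex_ideal [set: T] f.
  move=> /ms; apply=> [|_ [v ->]]; first exact: prime_ideal (vertex_ideal_prime _ _).
  exact: mem_vertex_ideal.
have idxT : indices [set: T] = [set: 'I_#|T|].
  by apply/setP => i; rewrite -(enum_valK i) mem_indices !inE.
have idxF : ~: indices F = indices (~: F).
  by apply/setP => i; rewrite -(enum_valK i) in_setC !mem_indices in_setC.
have rs : regular_seq (vertex_ideal [set: T]) I s by apply: regular_seq_of_quot.
rewrite /vertex_ideal idxT in ms' rs.
have cF : #|indices F| + 2 <= size s.
  by rewrite card_imset //; apply: enum_rank_inj.
have [g1 [g2 [S1 S2 r1 r2]]] := regular_pair hI cF ms' rs.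
rewrite idxF in S1 S2; rewrite -idxT in r1 r2.
have FU : ~: F = (NF :|: A) :|: V2.
  apply/setP => v; move/subsetP/(_ v): NFV2.
  rewrite /F -V2C !in_setU !in_setC !in_setD in_setC.
  by case: (v \in A); case: (v \in V2); case: (v \in NF) => // /(_ isT).
pose x := (\prod_(v in F) vertex_var k v)%R.
move: S1 S2 r1 r2; apply: (no_regular_pair (P := vertex_ideal (NF :|: A))
  (Q := vertex_ideal V2) (e := x)) => //; try exact: vertex_ideal_prime.
- apply: edge_ideal_sub_cover => u v uv.
  have cover a b : e a b -> a \in V1 -> (a \in A) || (b \in NF).
    move=> ab aV1; rewrite [b \in NF]inE; case: (boolP (a \in A)) => //= aA.
    by apply/exists_inP; exists a; rewrite ?in_setD ?aA.
  rewrite !in_setU; case: (eV _ _ uv) => -[hu hv].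
    by case/orP: (cover _ _ uv hu) => ->; rewrite ?orbT.
  by rewrite eC in uv; case/orP: (cover _ _ uv hv) => ->; rewrite ?orbT.
- by apply: edge_ideal_sub_cover => u v /eV [] [hu hv]; rewrite ?hu ?hv ?orbT.
- by apply: vertex_idealS; rewrite FU subsetUl.
- by apply: vertex_idealS; rewrite FU subsetUr.
- by apply: vertex_idealS; rewrite subsetT.
- by move=> f; rewrite FU /vertex_ideal /indices imsetU; apply: var_idealU.
- rewrite /x; elim/big_ind: _ => [|p q|v vF].
  + by case: (vertex_ideal_prime k (~: F)).
  + exact: (primeM (vertex_ideal_prime k (~: F))).
  + by apply: vertex_var_notin; rewrite inE vF.
- apply: mul_vertex_ideals => // w v wW vV.
  have xNF b : b \in NF -> I (x * vertex_var k b)%R.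
    rewrite inE => /exists_inP [u uF ub]; rewrite /x (bigD1 u) //= mulrAC.
    by apply: (ideal_mull _ hI); apply: mem_ideal_gen; exists u, b.
  case: (boolP (v \in NF)) => vNF.
    by rewrite [X in (x * X)%R]mulrC mulrA; apply: (ideal_mull _ hI); apply: xNF.
  case/setUP: wW => [wNF|wA].
    by rewrite mulrA; apply: (ideal_mull _ hI); apply: xNF.
  apply: (ideal_mulr _ hI); apply: mem_ideal_gen; exists w, v; split=> //.
  exact: AB.
- have [a aA] : exists a, a \in A.
    by apply/set0Pn; rewrite -card_gt0; apply: leq_trans deg3.
  move/(_ (vertex_var k a)) => /(_ (mem_vertex_ideal _)); rewrite inE aA orbT.
  move/(_ isT); apply: vertex_var_notin.
  by rewrite -[V2]setCK V2C inE negbK; apply: (subsetP AV1).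
- move/(_ (vertex_var k y) (mem_vertex_ideal yV2)); apply: vertex_var_notin.
  rewrite in_setU negb_or; apply/andP; split; apply/negP.
    rewrite inE => /exists_inP [v]; rewrite in_setD => /andP [/negP vA _] vy.
    by apply: vA; rewrite inE eC.
  by move/(subsetP AV1); rewrite -V2C inE yV2.
Qed.
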